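(* Let $K_i=[0,b_i,c_i,d_i]$, $i=1,2,3$, be three oriented lines (so $b_i^2+c_i^2=1$) with $\Delta_{bc}\ne0$ and $\Delta_1\neq0$. Then there is exactly one oriented circle $K_0=[a_0,b_0,c_0,d_0]$ tangent to all three lines, i.e. with $Q(K_0,K_i)=0$ for $i=1,2,3$, and it is given by $$a_0=\frac{2\Delta_{bc}}{\Delta_1},\qquad b_0=-\frac{\Delta_{cd}}{\Delta_1},\qquad c_0=\frac{\Delta_{bd}}{\Delta_1},\qquad d_0=\frac{b_0^2+c_0^2-1}{a_0}.$$ It is the circle of (signed) radius $1/a_0$ with centre $\Big(\dfrac{\Delta_{cd}}{2\Delta_{bc}},\,-\dfrac{\Delta_{bd}}{2\Delta_{bc}}\Big)$.
   Context: An oriented circle or line is a quadruple of reals $K=[a,b,c,d]$ with $b^2+c^2-ad=1$, representing the curve $N(x,y)=a(x^2+y^2)+2bx+2cy+d=0$. Here $a$ is its signed curvature: for $a\ne0$ it is the circle of radius $1/|a|$ centred at $(-b/a,-c/a)$, for $a=0$ it is a straight line. The orientation is such that points with $N<0$ lie to the left of the curve. A line through $(x_i,y_i)$ with direction $(\cos\tau_i,\sin\tau_i)$ is $[0,\ \sin\tau_i,\ -\cos\tau_i,\ 2y_i\cos\tau_i-2x_i\sin\tau_i]$. The inversive invariant of two oriented circles or lines is defined by $4Q(K_1,K_2)=2+a_1d_2+a_2d_1-2(b_1b_2+c_1c_2)$. Tangency (coincidence of tangent vectors at the common point) means $Q=0$. Writing $\det(p_i\ q_i\ r_i)$ for the $3\times3$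 determinant whose $i$-th row is $(p_i,q_i,r_i)$, $i=1,2,3$: $\Delta_1=-\det(b_i\ c_i\ d_i)$, $\Delta_{bc}=\det(b_i\ c_i\ 1)$, $\Delta_{bd}=\det(b_i\ d_i\ 1)$, $\Delta_{cd}=\det(c_i\ d_i\ 1)$. *)

(* Defs.v *)
From HB Require Import structures.
From mathcomp Require Import all_boot all_order all_algebra.
From mathcomp Require Import reals.

Set Implicit Arguments.
Unset Strict Implicit.
Unset Printing Implicit Defensive.

Import Order.TTheory GRing.Theory Num.Theory.
Local Open Scope ring_scope.

Record quadruple (R : realType) := Quadruple {
  qa : R;
  qb : R;
  qc : R;
  qd : R
}.

(* The orientation is part of the data: [a, b, c, d] and [-a, -b, -c, -d]
   have the same points but are different oriented circles or lines. *)
Definition oriented_curve (R : realType) (K : quadruple R) : Prop :=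
  qb K ^+ 2 + qc K ^+ 2 - qa K * qd K = 1.

Definition oriented_circle (R : realType) (K : quadruple R) : Prop :=
  oriented_curve K /\ qa K != 0.

Definition oriented_line (R : realType) (K : quadruple R) : Prop :=
  oriented_curve K /\ qa K = 0.

(* The curve is the zero set of N, and N < 0 on the left of it. *)
Definition N (R : realType) (K : quadruple R) (x y : R) : R :=
  qa K * (x ^+ 2 + y ^+ 2) + 2 * qb K * x + 2 * qc K * y + qd K.

Definition dist2 (R : realType) (p : R * R) (x y : R) : R :=
  (x - p.1) ^+ 2 + (y - p.2) ^+ 2.

(* A circle of signed radius r has geometric radius |r|; its left side is the
   interior (counterclockwise orientation) if r > 0 and the exterior if r < 0. *)
Definition circle_of_signed_radius (R : realType) (K : quadruple R)
    (r : R) (p : R * R) : Prop :=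
  r != 0 /\
  forall x y : R,
    (N K x y = 0 <-> dist2 p x y = r ^+ 2) /\
    (N K x y < 0 <->
       if 0 < r then dist2 p x y < r ^+ 2 else r ^+ 2 < dist2 p x y).

Definition Q (R : realType) (K1 K2 : quadruple R) : R :=
  (2 + qa K1 * qd K2 + qa K2 * qd K1 - 2 * (qb K1 * qb K2 + qc K1 * qc K2)) / 4.

Definition tangent (R : realType) (K1 K2 : quadruple R) : Prop := Q K1 K2 = 0.

Definition det3 (R : realType) (p q r : 'I_3 -> R) : R :=
  \det (\matrix_(i < 3, j < 3) [:: p i; q i; r i]`_j).

Definition Delta_1 (R : realType) (K : 'I_3 -> quadruple R) : R :=
  - det3 (fun i => qb (K i)) (fun i => qc (K i)) (fun i => qd (K i)).

Definition Delta_bc (R : realType) (K : 'I_3 -> quadruple R) : R :=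
  det3 (fun i => qb (K i)) (fun i => qc (K i)) (fun=> 1).

Definition Delta_bd (R : realType) (K : 'I_3 -> quadruple R) : R :=
  det3 (fun i => qb (K i)) (fun i => qd (K i)) (fun=> 1).

Definition Delta_cd (R : realType) (K : 'I_3 -> quadruple R) : R :=
  det3 (fun i => qc (K i)) (fun i => qd (K i)) (fun=> 1).

Definition tangent_circle (R : realType) (K : 'I_3 -> quadruple R)
    (K0 : quadruple R) : Prop :=
  oriented_circle K0 /\ forall i : 'I_3, tangent K0 (K i).

(* Main.v *)
Require Import Defs.
From HB Require Import structures.
From mathcomp Require Import all_boot all_order all_algebra.
From mathcomp Require Import reals ring lra.

(** Tangency of [a0, b0, c0, d0] to a line [0, b, c, d] reads
    b0 b + c0 c - (a0 / 2) d = 1: it is linear in the unknowns and does not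
    involve d0.  Three lines therefore give a 3x3 linear system for
    (b0, c0, a0 / 2) whose determinant is a nonzero multiple of Delta_1, and
    Cramer's rule ([tangent_lines_cramer]) produces the unique solution.
    Since Delta_bc is nonzero, so is a0, and the normalization
    b0^2 + c0^2 - a0 d0 = 1 then determines d0.

    The centre and the signed radius are those of any oriented circle
    ([oriented_circle_signed_radius]): completing the square turns N into
    a (dist2 - 1 / a^2), where the distance is taken from (-b/a, -c/a), so the
    sign of a decides which side of the circle is N < 0. *)

Set Implicit Arguments.
Unset Strict Implicit.
Unset Printing Implicit Defensive.

Import Order.TTheory GRing.Theory Num.Theory.
Local Open Scope ring_scope.

Lemma det3E (R : realType) (p q r : 'I_3 -> R) :
  det3 p q r =
    p 0 * (q 1 * r 2 - q 2 * r 1) - q 0 * (p 1 * r 2 - p 2 * r 1)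
    + r 0 * (p 1 * q 2 - p 2 * q 1).
Proof.
have e1 : lift ord0 ord0 = 1 :> 'I_3 by exact: val_inj.
have e2 : lift ord0 (lift ord0 ord0) = 2 :> 'I_3 by exact: val_inj.
have l10 : lift 1 ord0 = 0 :> 'I_3 by exact: val_inj.
have l11 : lift 1 (lift ord0 ord0) = 2 :> 'I_3 by exact: val_inj.
have l20 : lift 2 ord0 = 0 :> 'I_3 by exact: val_inj.
have l21 : lift 2 (lift ord0 ord0) = 1 :> 'I_3 by exact: val_inj.
rewrite /det3 (expand_det_row _ ord0) !big_ord_recl big_ord0 /cofactor.
rewrite !(expand_det_row _ ord0) !big_ord_recl !big_ord0 /cofactor !det_mx11.
rewrite !mxE /= ?e2 ?e1 ?l10 ?l11 ?l20 ?l21 /=.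
ring.
Qed.

Lemma tangent_lineE (R : realType) (K0 L : quadruple R) (hL : qa L = 0) :
  tangent K0 L <->
  qb K0 * qb L + qc K0 * qc L - qa K0 / 2 * qd L = 1.
Proof. by rewrite /tangent /Q hL; split=> h; lra. Qed.

(** Laplace expansion of the 4x4 determinant with rows (b_i, c_i, d_i, 1),
    i = 1, 2, 3, and a repetition of one of them, which is zero. *)
Lemma Delta_laplace (R : realType) (K : 'I_3 -> quadruple R) (i : 'I_3) :
  - Delta_cd K * qb (K i) + Delta_bd K * qc (K i) - Delta_bc K * qd (K i)
  = Delta_1 K.
Proof.
rewrite /Delta_1 /Delta_bc /Delta_bd /Delta_cd !det3E.
have [->|->|->] : [\/ i = 0, i = 1 | i = 2].
- case: i => -[|[|[|//]]] hi.
  + by apply: Or31; exact: val_inj.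
  + by apply: Or32; exact: val_inj.
  + by apply: Or33; exact: val_inj.
- ring.
- ring.
- ring.
Qed.

(** Cramer's rule for the tangency system; the fourth entry d0 of K0 is left
    free, since the invariant Q of K0 and a line does not contain it. *)
Lemma tangent_lines_cramer (R : realType) (K : 'I_3 -> quadruple R)
    (K0 : quadruple R) (hK : forall i, qa (K i) = 0) (h1 : Delta_1 K != 0) :
  (forall i, tangent K0 (K i)) <->
  [/\ qa K0 = 2 * Delta_bc K / Delta_1 K,
      qb K0 = - (Delta_cd K / Delta_1 K)
    & qc K0 = Delta_bd K / Delta_1 K].
Proof.
split=> [tK|[ha hb hc] i]; last first.
  apply/tangent_lineE => //; rewrite ha hb hc.
  rewrite -[RHS](divff h1) -{4}(Delta_laplace K i); field.
  exact: h1.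
have e i : 1 = qb K0 * qb (K i) + qc K0 * qc (K i) - qa K0 / 2 * qd (K i).
  by symmetry; apply/tangent_lineE.
(* In Delta_bc, Delta_bd and Delta_cd the column of ones replaces the column of
   one unknown.  The equations write it as a combination of the three columns,
   and of this only the multiple of the missing column contributes. *)
have det_e (p q : 'I_3 -> R) : det3 p q (fun=> 1) =
    det3 p q
      (fun i => qb K0 * qb (K i) + qc K0 * qc (K i) - qa K0 / 2 * qd (K i)).
  by rewrite !det3E -!e.
by split; apply: (mulIf h1); rewrite ?mulNr divfK //;
  rewrite /Delta_bc /Delta_bd /Delta_cd det_e /Delta_1 !det3E; field.
Qed.

Lemma oriented_circle_qd (R : realType) (K : quadruple R) :
  oriented_circle K -> qd K = (qb K ^+ 2 + qc K ^+ 2 - 1) / qa K.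
Proof.
by case=> hK a0; apply: (mulIf a0); rewrite divfK // -hK; ring.
Qed.

Lemma oriented_circle_N (R : realType) (K : quadruple R) (x y : R) :
  oriented_circle K ->
  N K x y = qa K * (dist2 (- (qb K / qa K), - (qc K / qa K)) x y
                    - (1 / qa K) ^+ 2).
Proof.
move=> hK; rewrite /N /dist2 /= (oriented_circle_qd hK).
by case: hK => _ a0; field.
Qed.

Lemma oriented_circle_signed_radius (R : realType) (K : quadruple R) :
  oriented_circle K ->
  circle_of_signed_radius K (1 / qa K) (- (qb K / qa K), - (qc K / qa K)).
Proof.
move=> hK; have a0 := hK.2.
split=> [|x y]; first by rewrite div1r invr_eq0.
rewrite (oriented_circle_N _ _ hK); set D := dist2 _ _ _; split.
  split=> [/eqP|->]; last by rewrite subrr mulr0.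
  by rewrite mulf_eq0 (negbTE a0) subr_eq0 => /eqP.
have -> : (0 < 1 / qa K) = (0 < qa K) by rewrite div1r invr_gt0.
case: (ltrP 0 (qa K)) => ha.
  by rewrite pmulr_rlt0 // subr_lt0.
by rewrite nmulr_rlt0 ?subr_gt0 // lt_neqAle a0.
Qed.

Theorem mainTheorem2 (R : realType) (K : 'I_3 -> quadruple R)
    (hK : forall i : 'I_3, oriented_line (K i))
    (hbc : Delta_bc K != 0) (h1 : Delta_1 K != 0) :
  (exists! K0 : quadruple R, tangent_circle K K0) /\
  (forall K0 : quadruple R, tangent_circle K K0 ->
    [/\ qa K0 = 2 * Delta_bc K / Delta_1 K,
        qb K0 = - (Delta_cd K / Delta_1 K),
        qc K0 = Delta_bd K / Delta_1 K,
        qd K0 = (qb K0 ^+ 2 + qc K0 ^+ 2 - 1) / qa K0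
      & circle_of_signed_radius K0 (1 / qa K0)
          (Delta_cd K / (2 * Delta_bc K), - (Delta_bd K / (2 * Delta_bc K)))]).
Proof.
have aK i : qa (K i) = 0 by case: (hK i).
have a0_neq0 : 2 * Delta_bc K / Delta_1 K != 0.
  by rewrite !mulf_neq0 ?invr_eq0 // pnatr_eq0.
split; last first.
  move=> K0 [circK0 /(tangent_lines_cramer K0 aK h1) [ha hb hc]].
  split=> //; first exact: oriented_circle_qd.
  have -> : (Delta_cd K / (2 * Delta_bc K), - (Delta_bd K / (2 * Delta_bc K)))
          = (- (qb K0 / qa K0), - (qc K0 / qa K0)).
    by rewrite ha hb hc; congr (_, _); field; rewrite hbc h1.
  exact: oriented_circle_signed_radius.
set a := 2 * _ / _ in a0_neq0; set b := - (Delta_cd K / Delta_1 K).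
set c := Delta_bd K / Delta_1 K.
exists (Quadruple a b c ((b ^+ 2 + c ^+ 2 - 1) / a)); split.
  split; last exact/tangent_lines_cramer.
  by split=> //; rewrite /oriented_curve /=; field.
move=> K' [circK' /(tangent_lines_cramer K' aK h1)].
have := oriented_circle_qd circK'.
by case: K' {circK'} => a' b' c' d' /= -> [-> -> ->].
Qed.
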